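(* Let $1,2,3,4,5$ be distinct vertices and let $s$ be a graph with no edge containing the vertex $1$. Then: (1) $s\wedge 12\wedge 13\;\sim\; s\wedge 23$; (2) $s\wedge 123\wedge 124\;\sim\; s\wedge 234$; (3) $s\wedge 123\wedge 145\;\sim\; s\wedge 2345$; (4) $s\wedge 12\wedge 134\;\sim\; s\wedge 234$. Here juxtaposed vertices denote the edge on those vertices (with multiplicity one), e.g. $123=\{1,2,3\}$.
   Context: Each vertex $v$ is also a boolean variable. A clause is a disjunction of literals; a Cnf is a conjunction of one or more clauses, viewed as a set of clauses; a Cnf is satisfiable if some truth assignment makes it true. An edge is a nonempty set of vertices; a graph is a nonempty multiset of edges, written $(e_1)^{n_1}\cdots(e_m)^{n_m}$ with $n_i$ the multiplicity of $e_i$. The edge $v_1\cdots v_k$ supports the $2^k$ clauses $l_1\vee\cdots\vee l_k$ with $l_i\in\{v_i,\overline{v_i}\}$. The edge $e$ with multiplicity $n$ corresponds to the set of all Cnfs $c_1\wedge\cdots\wedge c_n$ with $c_1,\dots,c_n$ pairwise distinct clauses supported on $e$. A graph $(e_1)^{n_1}\cdots(e_m)^{n_m}$ is identified with the set of all Cnfs $x_1\wedge\cdots\wedge x_m$ with $x_i$ in the set corresponding to $e_i$ with multiplicity $n_i$. For sets of Cnfs, $s_1\wedge s_2=\{x_1\wedge x_2: x_1\in s_1,x_2\in s_2\}$. A set of Cnfs is totally satisfiable if it is nonempty and every Cnf in it is satisfiable; otherwise it is unsatisfiable. $s_1\sim s_2$ (equi-satisfiable) means both are totally satisfiable or both are unsatisfiable.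 *)

(* Defs.v *)
From HB Require Import structures.
From mathcomp Require Import all_boot finmap multiset.
From mathcomp Require Import classical_sets.

Set Implicit Arguments.
Unset Strict Implicit.
Unset Printing Implicit Defensive.

Local Open Scope classical_set_scope.
Local Open Scope fset_scope.

(** ** Clauses and Cnfs *)

(* [(v, true)] is the literal v, [(v, false)] is its negation. *)
Notation literal V := (V * bool)%type.

Notation clause V := {fset literal V}.

Record cnf (V : choiceType) : Type := Cnf {
  cnf_clauses :> {fset clause V};
  cnf_neq0 : cnf_clauses != fset0
}.

HB.instance Definition _ (V : choiceType) := [isSub for @cnf_clauses V].
HB.instance Definition _ (V : choiceType) := [Choice of cnf V by <:].

Definition lit_true (V : choiceType) (a : V -> bool) (l : literal V) : Prop :=
  a l.1 = l.2.

Definition clause_true (V : choiceType) (a : V -> bool) (c : clause V) : Prop :=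
  exists l : literal V, l \in c /\ lit_true a l.

Definition cnf_true (V : choiceType) (a : V -> bool) (x : cnf V) : Prop :=
  forall c : clause V, c \in cnf_clauses x -> clause_true a c.

Definition satisfiable (V : choiceType) (x : cnf V) : Prop :=
  exists a : V -> bool, cnf_true a x.

(* A Cnf is a set of clauses, so a clause common to [x] and [y] occurs once. *)
Lemma cnf_and_neq0 (V : choiceType) (x y : cnf V) :
  cnf_clauses x `|` cnf_clauses y != fset0.
Proof. by rewrite fsetU_eq0 negb_and cnf_neq0. Qed.

Definition cnf_and (V : choiceType) (x y : cnf V) : cnf V :=
  Cnf (cnf_and_neq0 x y).

(** ** Sets of Cnfs *)

Definition wedge (V : choiceType) (s1 s2 : set (cnf V)) : set (cnf V) :=
  [set cnf_and x1 x2 | x1 in s1 & x2 in s2].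

Notation "s1 `/\` s2" := (wedge s1 s2) (at level 50, left associativity).

Definition totally_satisfiable (V : choiceType) (s : set (cnf V)) : Prop :=
  s !=set0 /\ forall x : cnf V, s x -> satisfiable x.

Definition unsatisfiable (V : choiceType) (s : set (cnf V)) : Prop :=
  ~ totally_satisfiable s.

Definition equi_satisfiable (V : choiceType) (s1 s2 : set (cnf V)) : Prop :=
  (totally_satisfiable s1 /\ totally_satisfiable s2) \/
  (unsatisfiable s1 /\ unsatisfiable s2).

(** ** Edges and graphs *)

Record edge (V : choiceType) : Type := Edge {
  edge_vertices :> {fset V};
  edge_neq0 : edge_vertices != fset0
}.

HB.instance Definition _ (V : choiceType) := [isSub for @edge_vertices V].
HB.instance Definition _ (V : choiceType) := [Choice of edge V by <:].

(* For [G : graph V], [graph_edges G e] is the multiplicity of the edge [e]. *)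
Record graph (V : choiceType) : Type := Graph {
  graph_edges :> {mset edge V}%mset;
  graph_neq0 : graph_edges != mset0
}.

(* The clauses l_1 \/ ... \/ l_k with l_i in {v_i, ~ v_i}, for e = v_1...v_k:
   [sigma v] is the sign of the literal on [v]. *)
Definition supports (V : choiceType) (e : edge V) (c : clause V) : Prop :=
  exists sigma : V -> bool, c = [fset (v, sigma v) | v in edge_vertices e].

(* Empty when n exceeds the number 2 ^ #|e| of clauses supported on [e]. *)
Definition edge_cnfs (V : choiceType) (e : edge V) (n : nat) : set (cnf V) :=
  [set x | exists cs : n.-tuple (clause V),
     [/\ uniq cs,
         forall c : clause V, c \in cs -> supports e c
       & cnf_clauses x =i cs]].

(* [e] ranges over the distinct edges e_1, ..., e_m of [G], and [xs e_i] is the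
   conjunct x_i; the values of [xs] outside of [G] are irrelevant. *)
Definition graph_cnfs (V : choiceType) (G : graph V) : set (cnf V) :=
  [set x | exists xs : edge V -> cnf V,
     (forall e : edge V, e \in graph_edges G ->
        edge_cnfs e (graph_edges G e) (xs e)) /\
     cnf_clauses x =
       \bigcup_(e <- finsupp (graph_edges G)) cnf_clauses (xs e)].

Lemma edge_of_neq0 (V : choiceType) (v : V) (vs : seq V) :
  [fset u in v :: vs] != fset0.
Proof. by apply/fset0Pn; exists v; rewrite !inE eqxx. Qed.

Definition edge_of (V : choiceType) (v : V) (vs : seq V) : edge V :=
  Edge (edge_of_neq0 v vs).

Lemma graph1_neq0 (V : choiceType) (e : edge V) : [mset e]%mset != mset0.
Proof. by apply/eqP => /msetP /(_ e); rewrite mset0E msetnxx. Qed.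

(* The graph consisting of the single edge [e], with multiplicity one. *)
Definition graph1 (V : choiceType) (e : edge V) : graph V :=
  Graph (graph1_neq0 e).

Definition edge_set (V : choiceType) (v : V) (vs : seq V) : set (cnf V) :=
  graph_cnfs (graph1 (edge_of v vs)).

(* Main.v *)
Require Import Defs.
From mathcomp Require Import all_boot finmap multiset.
From mathcomp Require Import classical_sets boolp.

(** The four equivalences are instances of one resolution step
    [equi_satisfiable_resolution]: when no edge of [s] contains [v],
    and neither do [vs] and [ws], the edges [v :: vs] and [v :: ws] can be traded
    for a single edge on the union of [vs] and [ws].

    Any clause [C \/ D] on the union, with [C] on [vs] and [D] on [ws], is the
    resolvent of [v \/ C] and [~ v \/ D], so an assignment satisfying these two
    satisfies [C \/ D].  Conversely, suppose that clauses [l \/ C] and [l' \/ D]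
    are given, with [l] and [l'] literals on [v].  Some assignment satisfies the
    Cnf from [s] and a clause on the union made of literals of [C] and [D];
    hence it satisfies [C] or [D], and the value of [v], which the Cnf from [s]
    ignores, can be reset to satisfy the other of the two given clauses through
    its literal on [v].  If [vs] and [ws] overlap, a clause on the union must
    choose one sign for every common vertex; taking it from [C] is enough, since
    it suffices that each literal of the chosen clause occurs in [C] or in [D].

    Total satisfiability is first unfolded
    ([totally_satisfiable_wedge_graph1]): a clause on an edge is a sign function
    [sigma], and an assignment satisfies it iff it agrees with [sigma] at some
    vertex of the edge. *)

Set Implicit Arguments.
Unset Strict Implicit.
Unset Printing Implicit Defensive.

Local Open Scope classical_set_scope.
Local Open Scope fset_scope.

Section Resolution.
Variable V : choiceType.
Implicit Types (a sigma : V -> bool) (v : V) (e : edge V) (x y : cnf V).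
Implicit Types (S T : set (cnf V)).

Lemma equi_satisfiable_iff S T :
  (totally_satisfiable S <-> totally_satisfiable T) -> equi_satisfiable S T.
Proof.
move=> ST; have [satS|unsatS] := pselect (totally_satisfiable S).
  by left; split; last exact/ST.
by right; split=> // /ST.
Qed.

Definition edge_clause e sigma : clause V :=
  [fset (u, sigma u) | u in edge_vertices e].

(** Satisfaction of [edge_clause e sigma], without reference to literals. *)
Definition edge_true a e sigma : Prop :=
  exists2 u, u \in edge_vertices e & a u = sigma u.

Lemma clause_true_edge a e sigma :
  clause_true a (edge_clause e sigma) <-> edge_true a e sigma.
Proof.
split=> [[_ [/imfsetP[/= u ue ->] au]]|[u ue au]]; first by exists u.
by exists (u, sigma u); split=> //; apply/imfsetP; exists u.
Qed.

Lemma cnf_true_and a x y :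
  cnf_true a (cnf_and x y) <-> cnf_true a x /\ cnf_true a y.
Proof.
split=> [xy|[xT yT] c]; last by rewrite inE => /orP[/xT|/yT].
by split=> c cin; apply: xy; rewrite inE cin ?orbT.
Qed.

Lemma fset1_neq0 (K : choiceType) (k : K) : [fset k] != fset0.
Proof. by apply/fset0Pn; exists k; rewrite inE. Qed.

Definition edge_cnf e sigma : cnf V := Cnf (fset1_neq0 (edge_clause e sigma)).

Lemma cnf_true_edge a e sigma :
  cnf_true a (edge_cnf e sigma) <-> edge_true a e sigma.
Proof.
rewrite -clause_true_edge; split=> [eT|eT c]; last by rewrite inE => /eqP->.
by apply: eT; rewrite inE.
Qed.

(** With multiplicity one a Cnf on [e] is a single clause, and a clause on [e] is
    a choice of signs. *)
Lemma graph_cnfs1 e : graph_cnfs (graph1 e) = range (edge_cnf e).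
Proof.
have mult1 : graph_edges (graph1 e) e = 1%N by rewrite /= msetnxx.
have mem1 : e \in graph_edges (graph1 e) by rewrite /= in_mset mult1.
have supp1 : finsupp (graph_edges (graph1 e)) = [fset e].
  by rewrite /= finsupp_msetn.
apply/seteqP; split=> [x [xs [xsG xE]]|_ [sigma _ <-]].
  have := xsG _ mem1; rewrite mult1 => -[cs [_ cs_supp xsE]].
  case: (tupleP cs) xsE cs_supp => c cs' xsE cs_supp.
  have [|sigma cE] := cs_supp c; first by rewrite inE eqxx.
  exists sigma => //; apply: val_inj => /=.
  rewrite xE supp1 big_seq_fset1; apply/fsetP => c'.
  by rewrite xsE (tuple0 cs') !inE /edge_clause -cE.
exists (fun=> edge_cnf e sigma); split; last by rewrite supp1 big_seq_fset1.
move=> e' /=; rewrite in_mset1 => /eqP ->; rewrite msetnxx.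
exists [tuple edge_clause e sigma]; split=> //.
  by move=> c; rewrite inE => /eqP->; exists sigma.
by move=> c; rewrite !inE.
Qed.

(** Every edge supports a clause, so the wedge is nonempty as soon as [S] is; this
    is why nonemptiness only concerns [S] on the right-hand side. *)
Lemma totally_satisfiable_wedge_graph1 S e :
  totally_satisfiable (S `/\` graph_cnfs (graph1 e)) <->
  S !=set0 /\ forall x sigma, S x ->
    exists2 a, cnf_true a x & edge_true a e sigma.
Proof.
rewrite graph_cnfs1; split=> [[[_ [x Sx _]] sat]|[[x Sx] sat]].
  split=> [|y sigma Sy]; first by exists x.
  have [|a /cnf_true_and[yT /cnf_true_edge eT]] :=
    sat (cnf_and y (edge_cnf e sigma)).
    by exists y => //; exists (edge_cnf e sigma).
  by exists a.
split.
  exists (cnf_and x (edge_cnf e xpredT)), x => //.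
  by exists (edge_cnf e xpredT) => //; exists xpredT.
move=> _ [y Sy [_ [sigma _ <-] <-]]; have [a yT eT] := sat y sigma Sy.
by exists a; apply/cnf_true_and; split=> //; apply/cnf_true_edge.
Qed.

Lemma totally_satisfiable_wedge_graph12 S e1 e2 :
  totally_satisfiable
    (S `/\` graph_cnfs (graph1 e1) `/\` graph_cnfs (graph1 e2)) <->
  S !=set0 /\ forall x sigma1 sigma2, S x ->
    exists a, [/\ cnf_true a x, edge_true a e1 sigma1 & edge_true a e2 sigma2].
Proof.
rewrite totally_satisfiable_wedge_graph1 graph_cnfs1.
split=> [[[_ [x Sx _]] sat]|[[x Sx] sat]].
  split=> [|y sigma1 sigma2 Sy]; first by exists x.
  have [|a /cnf_true_and[yT /cnf_true_edge e1T] e2T] :=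
    sat (cnf_and y (edge_cnf e1 sigma1)) sigma2.
    by exists y => //; exists (edge_cnf e1 sigma1).
  by exists a.
split.
  exists (cnf_and x (edge_cnf e1 xpredT)), x => //.
  by exists (edge_cnf e1 xpredT) => //; exists xpredT.
move=> _ sigma2 [y Sy [_ [sigma1 _ <-] <-]].
have [a [yT e1T e2T]] := sat y sigma1 sigma2 Sy.
by exists a => //; apply/cnf_true_and; split=> //; apply/cnf_true_edge.
Qed.

Definition update a v (b : bool) : V -> bool := fun u => if u == v then b else a u.

(** No literal on [v] occurs in a Cnf of [G], so the value of [v] is free. *)
Lemma cnf_true_update (G : graph V) x a v b :
    (forall e, e \in graph_edges G -> v \notin edge_vertices e) ->
  graph_cnfs G x -> cnf_true a x -> cnf_true (update a v b) x.
Proof.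
move=> vG [xs [xsG xE]] xT c cx.
have [l [lc la]] := xT c cx; exists l; split=> //.
rewrite /lit_true /update; case: eqP => // lv.
move: cx; rewrite xE => /bigfcupP[e /andP[+ _] cxs]; rewrite msuppE => eG.
have [cs [_ cs_supp xsE]] := xsG e eG.
rewrite xsE in cxs; have [sigma cE] := cs_supp c cxs.
move: lc lv; rewrite cE => /imfsetP[/= u ue ->] /= uv.
by move: (vG e eG); rewrite -uv ue.
Qed.

Lemma edge_of_inE v (vs : seq V) : edge_vertices (edge_of v vs) =i v :: vs.
Proof. by move=> u; rewrite /= !inE. Qed.

Lemma edge_true_update_pivot a v (vs : seq V) sigma :
  edge_true (update a v (sigma v)) (edge_of v vs) sigma.
Proof. by exists v; rewrite ?edge_of_inE ?mem_head // /update eqxx. Qed.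

(** Variable elimination: [f] is the union of the two edges with the pivot [v]
    removed.  The lists [vs] and [ws] may share vertices, as they do when
    resolving two edges with a second common vertex. *)
Theorem equi_satisfiable_resolution (G : graph V) v (vs ws : seq V) (f : edge V) :
    (forall e, e \in graph_edges G -> v \notin edge_vertices e) ->
    edge_vertices f =i vs ++ ws -> v \notin edge_vertices f ->
  equi_satisfiable (graph_cnfs G `/\` edge_set v vs `/\` edge_set v ws)
                   (graph_cnfs G `/\` graph_cnfs (graph1 f)).
Proof.
move=> vG fE vf; apply: equi_satisfiable_iff.
rewrite totally_satisfiable_wedge_graph12 totally_satisfiable_wedge_graph1.
split=> -[G0 sat]; split=> //.
  (* The clause [sigma] is the resolvent of its extensions by [v] and [~ v]. *)
  move=> x sigma Gx.
  have [a [xT [u1 u1e a1] [u2 u2e a2]]] :=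
    sat x (update sigma v true) (update sigma v false) Gx.
  exists a => //; move: u1e a1 u2e a2; rewrite !edge_of_inE !inE /update.
  case: eqP => [->|_] /= u1vs au1; last by exists u1; rewrite // fE mem_cat u1vs.
  case: eqP => [->|_] /= u2ws au2; first by rewrite au1 in au2.
  by exists u2; rewrite // fE mem_cat u2ws orbT.
move=> x sigma1 sigma2 Gx.
(* A vertex common to [vs] and [ws] takes its sign from [sigma1]. *)
have [a xT [u uf]] := sat x (fun u => if u \in vs then sigma1 u else sigma2 u) Gx.
have uv : (u == v) = false by apply: contraNF vf => /eqP<-.
(* The clause satisfied at [u] keeps its truth when [v], which differs from [u],
   is reset in favour of the other clause. *)
case: ifP => [uvs|uvs] au.
  exists (update a v (sigma2 v)); split; first exact: cnf_true_update vG Gx xT.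
    by exists u; rewrite ?edge_of_inE ?inE ?uvs ?orbT // /update uv.
  exact: edge_true_update_pivot.
move: uf; rewrite fE mem_cat uvs => /= uws.
exists (update a v (sigma1 v)); split; first exact: cnf_true_update vG Gx xT.
  exact: edge_true_update_pivot.
by exists u; rewrite ?edge_of_inE ?inE ?uws ?orbT // /update uv.
Qed.

End Resolution.

Theorem mainTheorem7 (V : choiceType) (v1 v2 v3 v4 v5 : V)
    (v_uniq : uniq [:: v1; v2; v3; v4; v5])
    (s : graph V)
    (s_v1 : forall e : edge V, e \in graph_edges s -> v1 \notin edge_vertices e) :
  [/\ equi_satisfiable
        (graph_cnfs s `/\` edge_set v1 [:: v2] `/\` edge_set v1 [:: v3])
        (graph_cnfs s `/\` edge_set v2 [:: v3]),
      equi_satisfiable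
        (graph_cnfs s `/\` edge_set v1 [:: v2; v3] `/\` edge_set v1 [:: v2; v4])
        (graph_cnfs s `/\` edge_set v2 [:: v3; v4]),
      equi_satisfiable
        (graph_cnfs s `/\` edge_set v1 [:: v2; v3] `/\` edge_set v1 [:: v4; v5])
        (graph_cnfs s `/\` edge_set v2 [:: v3; v4; v5])
    & equi_satisfiable
        (graph_cnfs s `/\` edge_set v1 [:: v2] `/\` edge_set v1 [:: v3; v4])
        (graph_cnfs s `/\` edge_set v2 [:: v3; v4])].
Proof.
move: v_uniq => /= /andP[]; rewrite !inE !negb_or => /and4P[n12 n13 n14 n15] _.
split; apply: equi_satisfiable_resolution => //.
- by move=> u; rewrite edge_of_inE.
- by rewrite edge_of_inE !inE !negb_or n12.
- (* The shared vertex [v2] occurs twice in the concatenation. *)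
  by move=> u; rewrite edge_of_inE !inE; case: (u == v2); rewrite ?orbT.
- by rewrite edge_of_inE !inE !negb_or n12 n13.
- by move=> u; rewrite edge_of_inE.
- by rewrite edge_of_inE !inE !negb_or n12 n13 n14.
- by move=> u; rewrite edge_of_inE.
- by rewrite edge_of_inE !inE !negb_or n12 n13.
Qed.
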